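(* Let $d\ge 1$ and $k\ge d+2$ be integers. Let $\mu_1,\dots,\mu_k\in\mathbb{R}^d$ and let \[\rho(x)=\sum_{i=1}^k \frac{1}{k\sqrt{(2\pi)^d}}\,e^{-\frac12\|x-\mu_i\|^2},\qquad x\in\mathbb{R}^d,\] be the mixture of $k$ equally weighted normal distributions with identity covariance and means $\mu_1,\dots,\mu_k$. Assume that the point configuration $(\mu_1,\dots,\mu_k)$ is reconstructible from its multiset of pairwise distances. Then $\rho$ is uniquely reconstructible, up to a rigid motion, from its distribution of distances: if $\nu_1,\dots,\nu_k\in\mathbb{R}^d$ and $\bar\rho(x)=\sum_{i=1}^k \frac{1}{k\sqrt{(2\pi)^d}}e^{-\frac12\|x-\nu_i\|^2}$ has the same distribution of distances as $\rho$, then there exists $g\in E(d)$ with $\rho(x)=\bar\rho(g\cdot x)$ for all $x\in\mathbb{R}^d$.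
   Context: $E(d)$ denotes the Euclidean group of rigid motions of $\mathbb{R}^d$ and $\|\cdot\|$ the Euclidean norm. For a probability density $\rho$ on $\mathbb{R}^d$, its distribution of distances is the probability density $r(\Delta)$ of the random variable $\Delta=\|x_1-x_2\|^2$, where $x_1,x_2$ are drawn independently according to $\rho$. A point configuration $p_1,\dots,p_k\in\mathbb{R}^d$ is called reconstructible from its multiset of pairwise distances if for every configuration $q_1,\dots,q_k\in\mathbb{R}^d$ whose multiset of pairwise distances $\{\|q_i-q_j\|: i<j\}$ equals that of $p_1,\dots,p_k$, there exist $g\in E(d)$ and a permutation $\pi$ of $\{1,\dots,k\}$ with $g\cdot p_{\pi(i)}=q_i$ for all $i$. *)

(* Defs.v *)
From HB Require Import structures.
From mathcomp Require Import all_boot all_order all_algebra all_fingroup.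
From mathcomp Require Import all_classical all_reals all_analysis.
Set Implicit Arguments. Unset Strict Implicit. Unset Printing Implicit Defensive.
Import Order.TTheory GRing.Theory Num.Theory.
Local Open Scope classical_set_scope.
Local Open Scope ring_scope.

Section Defs.
Variable R : realType.

Definition sqnorm (d : nat) (v : 'rV[R]_d) : R := \sum_(i < d) (v 0 i) ^+ 2.

Definition enorm (d : nat) (v : 'rV[R]_d) : R := Num.sqrt (sqnorm v).

Definition rigid_motion (d : nat) (g : 'rV[R]_d -> 'rV[R]_d) : Prop :=
  exists (Q : 'M[R]_d) (b : 'rV[R]_d),
    Q *m Q^T = 1%:M /\ forall x, g x = x *m Q + b.

Definition pair_dists (d k : nat) (p : 'I_k -> 'rV[R]_d) : seq R :=
  [seq enorm (p ij.1 - p ij.2) | ij <- enum [pred ij : 'I_k * 'I_k | (nat_of_ord ij.1 < nat_of_ord ij.2)%N]].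

Definition reconstructible (d k : nat) (p : 'I_k -> 'rV[R]_d) : Prop :=
  forall q : 'I_k -> 'rV[R]_d, perm_eq (pair_dists p) (pair_dists q) ->
    exists g, rigid_motion g /\ exists s : 'S_k, forall i, g (p (s i)) = q i.

Definition gauss_mixture (d k : nat) (mu : 'I_k -> 'rV[R]_d) (x : 'rV[R]_d) : R :=
  \sum_(i < k) (k%:R * Num.sqrt ((2 * pi) ^+ d))^-1 *
               expR (- (2^-1 * sqnorm (x - mu i))).

(* Lebesgue integral over R^n, as the iterated Lebesgue integral (Tonelli). *)
Fixpoint iter_int (n : nat) : (n.-tuple R -> \bar R) -> \bar R :=
  match n return (n.-tuple R -> \bar R) -> \bar R with
  | 0 => fun f => f [tuple]
  | m.+1 => fun f =>
      (\int[@lebesgue_measure R]_x iter_int (fun t : m.-tuple R => f [tuple of x :: t]))%E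
  end.

Definition Rd_int (d : nat) (f : 'rV[R]_d -> \bar R) : \bar R :=
  iter_int (fun t : d.-tuple R => f (\row_i tnth t i)).

(* Distribution of distances of a density rho on R^d: the law of
   ||x1 - x2||^2 with x1, x2 i.i.d. with density rho, i.e.
   B |-> P(||x1 - x2||^2 \in B) for Borel B. *)
Definition dist_of_dists (d : nat) (rho : 'rV[R]_d -> R) (B : set R) : \bar R :=
  Rd_int (fun x => Rd_int (fun y =>
     ((rho x * rho y)%:E * (\1_B (sqnorm (x - y)) : R)%:E)%E)).

Definition same_dist_of_dists (d : nat) (rho rho' : 'rV[R]_d -> R) : Prop :=
  forall B : set R, measurable B -> dist_of_dists rho B = dist_of_dists rho' B.

End Defs.

(* Main.v *)
(* If X1, X2 are independent with density rho, then X1 - X2 is a mixture of the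
   normal laws N(mu_i - mu_j, 2 I), so completing the square twice gives
     E exp (- s |X1 - X2|^2) = C(s) \sum_(i, j) exp (- t |mu_i - mu_j|^2)
   with t = s / (1 + 4 s) and C(s) > 0 independent of mu.  This expectation is
   finite for s > - 1 / 4, and s = - n / (1 + 4 n) gives t = - n: the distribution
   of distances determines all power sums of the numbers exp (|mu_i - mu_j|^2),
   hence their multiset.  Discarding the diagonal pairs and halving, it determines
   the multiset of pairwise distances. *)
Require Import Defs.
From HB Require Import structures.
From mathcomp Require Import all_boot all_order all_algebra all_fingroup.
From mathcomp Require Import all_classical all_reals all_analysis.
From mathcomp Require Import measurable_realfun ring lra.
Set Implicit Arguments. Unset Strict Implicit. Unset Printing Implicit Defensive.
Import Order.TTheory GRing.Theory Num.Theory.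
Local Open Scope classical_set_scope.
Local Open Scope ring_scope.

(** * Iterated integrals as integrals against a sigma-finite measure *)

(** Tonelli for the product measure, transported along [phi]. The measurable left inverse [psi]
    serves to carry sigma-finiteness over to the image, so that the construction can be repeated one
    coordinate at a time. *)
Lemma pushforward_prod_sigma_finite d1 d2 d3 (T1 : measurableType d1)
    (T2 : measurableType d2) (T3 : measurableType d3) (R : realType)
    (m1 : {sigma_finite_measure set T1 -> \bar R})
    (m2 : {sigma_finite_measure set T2 -> \bar R})
    (phi : T1 * T2 -> T3) (psi : T3 -> T1 * T2) :
  measurable_fun setT phi -> measurable_fun setT psi -> cancel phi psi ->
  exists M : {sigma_finite_measure set T3 -> \bar R},
    forall f : T3 -> \bar R, (forall t, 0 <= f t)%E -> measurable_fun setT f ->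
    (\int[M]_t f t = \int[m1]_x \int[m2]_y f (phi (x, y)))%E.
Proof.
move=> mphi mpsi phiK.
pose P := (m1 \x m2)%E.
pose Q' : {measure set T3 -> \bar R} := pushforward P phi.
pose Q := Q' mphi.
have sfQ : sigma_finite setT Q.
  have /sigma_finiteP[F [TF ndF Foo]] := sigma_finiteT m1.
  have /sigma_finiteP[G [TG ndG Goo]] := sigma_finiteT m2.
  (* Since [psi] undoes [phi], pulling these sets back along [phi] gives the rectangles [F n] times
     [G n], of finite product measure. Both sequences increase, so the larger of two indices serves
     both coordinates. *)
  exists (fun n => psi @^-1` (F n `*` G n)).
    apply/esym/seteqP; split=> // t _.
    have [n _ Fn] : (\bigcup_i F i) (psi t).1 by rewrite -TF.
    have [p _ Gp] : (\bigcup_i G i) (psi t).2 by rewrite -TG.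
    exists (maxn n p) => //; split.
      by move: Fn; exact/subsetPset/ndF/leq_maxl.
    by move: Gp; exact/subsetPset/ndG/leq_maxr.
  move=> n; have [mF Ffin] := Foo n; have [mG Gfin] := Goo n; split.
    by rewrite -[X in measurable X]setTI; apply: mpsi => //; exact: measurableX.
  rewrite /Q /= /pushforward/= (_ : _ @^-1` _ = F n `*` G n); last first.
    by apply/seteqP; split => z /=; rewrite phiK.
  by rewrite product_measure1E// lte_mul_pinfty// ge0_fin_numE.
pose Qs := HB.pack_for {sigma_finite_measure set T3 -> \bar R}
  (Measure.sort Q) (Measure_isSigmaFinite.Build _ _ _ (Measure.sort Q) sfQ).
exists Qs => f f0 mf.
have -> : (\int[Qs]_t f t = \int[pushforward P phi]_t f t)%E by [].
rewrite ge0_integral_pushforward//= preimage_setT.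
have mfphi : measurable_fun setT (f \o phi) by exact: measurableT_comp.
by rewrite fubini_tonelli1//= => z; exact: f0.
Qed.

Section IterInt.
Variable R : realType.

Local Notation mtuple n := (n.-tuple (measurableTypeR R)).

(** A single measure makes monotone convergence, additivity and Tonelli available for [iter_int].
    The induction pushes the product of Lebesgue measure with the previous [M] along the cons
    map. *)
Lemma iter_int_measure (n : nat) :
  exists M : {sigma_finite_measure set (mtuple n) -> \bar R},
    forall f : mtuple n -> \bar R, (forall t, 0 <= f t)%E ->
    measurable_fun [set: mtuple n] f ->
    iter_int f = (\int[M]_t f t)%E.
Proof.
elim: n => [|n [M IH]].
  (* Integration over a point is evaluation, hence a Dirac mass. *)
  exists (dirac ([tuple] : mtuple 0)).
  move=> f f0 mf /=.
  by rewrite integral_dirac// diracT mul1e.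
pose phi (z : measurableTypeR R * mtuple n) : mtuple n.+1 := [tuple of z.1 :: z.2].
have mphi : measurable_fun setT phi.
  exact: (@measurable_cons _ _ _ _ fst n snd).
pose psi (t : mtuple n.+1) : measurableTypeR R * mtuple n := (thead t, [tuple of behead t]).
have mpsi : measurable_fun setT psi.
  apply: measurable_fun_pair; last exact: measurable_behead.
  exact: measurable_tnth.
have phiK : cancel phi psi.
  by case=> x t; rewrite /psi/= theadE; congr (_, _); exact/val_inj.
have [Q QE] := pushforward_prod_sigma_finite (@lebesgue_measure R) M mphi mpsi phiK.
exists Q => f f0 mf; rewrite QE//=.
apply: eq_integral => x _; rewrite IH//.
apply: (measurableT_comp mf).
exact: (measurable_cons (measurable_cst x) (@measurable_id _ _ setT)).
Qed.

End IterInt.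

(** * From the law of a statistic to expectations of nonnegative functions of it *)

Section WeightedLaw.
Context d (Z : measurableType d) (R : realType) (P : {measure set Z -> \bar R}).
Import HBNNSimple.

(** The simple functions [h_ n] depend on [h] alone, so the right-hand side sees [W] only through
    the weighted measures of the sets where [S] lies in a given Borel set. Two weights giving [S]
    the same law therefore give the same integral. *)
Lemma ge0_integral_comp_approx (W : Z -> R) (S : Z -> R) (h : R -> \bar R)
    (mh : measurable_fun setT h) (h_ := nnsfun_approx measurableT mh) :
  (forall z, 0 <= W z) -> measurable_fun setT W -> measurable_fun setT S ->
  (forall r, 0 <= h r)%E ->
  (\int[P]_z ((W z)%:E * h (S z)))%E = limn (fun n =>
    \sum_(r \in range (h_ n))
      (r%:E * \int[P]_z ((W z)%:E * (\1_(h_ n @^-1` [set r]) (S z))%:E)))%E.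
Proof.
move=> W0 mW mS h0.
have mWE : measurable_fun setT (fun z => (W z)%:E) by exact/measurable_EFinP.
have mhS n : measurable_fun setT (fun z => (h_ n (S z))%:E).
  by apply/measurable_EFinP; exact: measurableT_comp.
transitivity (limn (fun n => \int[P]_z ((W z)%:E * (h_ n (S z))%:E)))%E.
  rewrite -monotone_convergence//; last 3 first.
  - by move=> n; exact: emeasurable_funM.
  - by move=> n z _; rewrite mule_ge0// lee_fin.
  - move=> z _ m n mn; rewrite lee_wpmul2l// lee_fin//.
    exact/lefP/nd_nnsfun_approx.
  apply: eq_integral => z _; apply/esym/cvg_lim => //.
  have hS := cvg_nnsfun_approx measurableT mh (fun x _ => h0 x) (I : setT (S z)).
  exact: (cvgeZl (isT : (W z)%:E \is a fin_num) hS).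
apply/congr_lim/funext => n.
have mind r : measurable_fun setT
    (fun z => (W z)%:E * (\1_(h_ n @^-1` [set r]) (S z))%:E)%E.
  apply: emeasurable_funM => //; apply/measurable_EFinP.
  by apply: measurableT_comp => //; exact: measurable_indic.
(* A simple function is the finite sum of its values times the indicators of its level sets. *)
transitivity (\int[P]_z \sum_(r \in range (h_ n))
    ((W z)%:E * (r%:E * (\1_(h_ n @^-1` [set r]) (S z))%:E)))%E.
  apply: eq_integral => z _.
  rewrite fimfunE -fsumEFin// ge0_mule_fsumr// => r.
  exact: nnfun_muleindic_ge0.
rewrite ge0_integral_fsum//; last 2 first.
- move=> r; under eq_fun do rewrite muleCA.
  exact: emeasurable_funM.
- move=> r z _; apply: mule_ge0; first by rewrite lee_fin.
  exact: nnfun_muleindic_ge0.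
(* Writing [r] as a value of [h_ n] shows that it is nonnegative, which allows pulling it out of the
   integral. *)
apply: eq_fsbigr => r /[!inE] -[y _ <-].
under eq_integral do rewrite muleCA.
by rewrite ge0_integralZl ?lee_fin// => z _; rewrite mule_ge0 ?lee_fin.
Qed.

Lemma eq_ge0_integral_comp (W W' : Z -> R) (S : Z -> R) :
  (forall z, 0 <= W z) -> measurable_fun setT W ->
  (forall z, 0 <= W' z) -> measurable_fun setT W' ->
  measurable_fun setT S ->
  (forall B, measurable B ->
    \int[P]_z ((W z)%:E * (\1_B (S z))%:E) =
    \int[P]_z ((W' z)%:E * (\1_B (S z))%:E))%E ->
  forall h : R -> \bar R, measurable_fun setT h -> (forall r, 0 <= h r)%E ->
  (\int[P]_z ((W z)%:E * h (S z)) = \int[P]_z ((W' z)%:E * h (S z)))%E.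
Proof.
move=> W0 mW W'0 mW' mS WW' h mh h0.
rewrite !ge0_integral_comp_approx//.
apply/congr_lim/funext => n.
by apply: eq_fsbigr => r _; rewrite WW'.
Qed.

End WeightedLaw.

(** * Product integrands and the one-dimensional Gaussian integral *)

Section GaussianIntegrals.
Variable R : realType.
Local Notation mtuple n := (n.-tuple (measurableTypeR R)).
Local Notation row_of t := (\row_i tnth t i).

Lemma Rd_int2_measure (d : nat) :
  exists P : {measure set (mtuple d * mtuple d)%type -> \bar R},
    forall F : 'rV[R]_d -> 'rV[R]_d -> \bar R, (forall x y, 0 <= F x y)%E ->
    measurable_fun [set: mtuple d * mtuple d] (fun z => F (row_of z.1) (row_of z.2)) ->
    Rd_int (fun x => Rd_int (F x)) = (\int[P]_z F (row_of z.1) (row_of z.2))%E.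
Proof.
have [M ME] := iter_int_measure R d.
exists (M \x M)%E => F F0 mF.
rewrite fubini_tonelli1//= /Rd_int.
have inner t : iter_int (fun u : d.-tuple R => F (row_of t) (row_of u)) =
    (\int[M]_u F (row_of t) (row_of u))%E.
  by apply: ME => //; apply: (measurableT_comp mF (@measurable_pair1 _ _ _ _ t)).
under eq_fun do rewrite inner.
apply: ME => [t|].
  by apply: integral_ge0.
exact: (@measurable_fun_fubini_tonelli_F _ _ _ _ _ M _ mF).
Qed.

(** The constant [c] is there for the induction: in the inner integral it absorbs the factor
    [g ord0 x] of the outer variable. *)
Lemma iter_int_prod (n : nat) (g : 'I_n -> R -> R) (K : 'I_n -> R) (c : R) :
  0 <= c -> (forall i x, 0 <= g i x) -> (forall i, measurable_fun setT (g i)) ->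
  (forall i, \int[@lebesgue_measure R]_x (g i x)%:E = (K i)%:E)%E ->
  iter_int (fun t : n.-tuple R => (c * \prod_i g i (tnth t i))%:E) =
  (c * \prod_i K i)%:E.
Proof.
move=> c0 g0 mg gK.
have K0 i : 0 <= K i.
  by rewrite -lee_fin -gK; apply: integral_ge0 => x _; rewrite lee_fin.
elim: n g K c c0 g0 mg gK K0 => [|n IH] g K c c0 g0 mg gK K0 /=.
  by rewrite !big_ord0.
rewrite big_ord_recl.
transitivity (\int[@lebesgue_measure R]_x
    ((c * \prod_(i < n) K (lift ord0 i))%:E * (g ord0 x)%:E))%E.
  apply: eq_integral => x _.
  rewrite -EFinM mulrAC -(IH (fun i => g (lift ord0 i)))//; last by rewrite mulr_ge0.
  congr iter_int; apply/funext => t; rewrite big_ord_recl mulrA.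
  congr (_ * _)%:E; apply: eq_bigr => i _.
  by congr (g _ _); exact: tnthS.
rewrite ge0_integralZl//=.
- by rewrite gK -EFinM [K _ * _]mulrC mulrA.
- by apply/measurable_EFinP; exact: mg.
- by move=> x _; rewrite lee_fin.
- by rewrite lee_fin mulr_ge0// prodr_ge0.
Qed.

Lemma Rd_int_prod (d : nat) (g : 'I_d -> R -> R) (K : 'I_d -> R) (c : R) :
  0 <= c -> (forall i x, 0 <= g i x) -> (forall i, measurable_fun setT (g i)) ->
  (forall i, \int[@lebesgue_measure R]_x (g i x)%:E = (K i)%:E)%E ->
  Rd_int (fun x : 'rV[R]_d => (c * \prod_i g i (x 0 i))%:E) =
  (c * \prod_i K i)%:E.
Proof.
move=> c0 g0 mg gK; rewrite -(iter_int_prod c0 g0 mg gK) /Rd_int.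
by congr iter_int; apply/funext => t; under eq_bigr do rewrite mxE.
Qed.

Lemma integral_gauss (a m : R) : 0 < a ->
  (\int[@lebesgue_measure R]_x (expR (- (a * (x - m) ^+ 2)))%:E =
   (Num.sqrt (pi / a))%:E)%E.
Proof.
move=> a0.
(* The standard deviation for which the normal density with mean [m] has exponent
   [- a * (x - m) ^+ 2]; its total mass 1 then gives the integral. *)
pose s : R := Num.sqrt (2 * a)^-1.
have s0 : 0 < s by rewrite sqrtr_gt0 invr_gt0 mulr_gt0.
have s2 : s ^+ 2 *+ 2 = a^-1.
  rewrite sqr_sqrtr ?invr_ge0 ?mulr_ge0 ?ltW// -mulr_natr; field.
  by rewrite gt_eqF.
have := integral_normal_pdf m s.
rewrite normal_pdfE ?gt_eqF//.
have peakE : normal_peak s = (Num.sqrt (pi / a))^-1.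
  by rewrite /normal_peak -mulrnAl s2 mulrC.
have funE x : normal_fun m s x = expR (- (a * (x - m) ^+ 2)).
  by rewrite /normal_fun s2 invrK mulNr mulrC.
have pa : 0 < Num.sqrt (pi / a) :> R by rewrite sqrtr_gt0 divr_gt0 ?pi_gt0.
under eq_integral do rewrite funE peakE EFinM.
rewrite ge0_integralZl//; last first.
  apply/measurable_EFinP; rewrite -[X in measurable_fun _ X](_ : normal_fun m s = _).
    exact: measurable_normal_fun.
  exact/funext.
by move=> /(congr1 (fun u => (Num.sqrt (pi / a))%:E * u)%E);
  rewrite muleA -EFinM divff ?gt_eqF// mul1e mule1.
Qed.

End GaussianIntegrals.

(** * Power sums determine a multiset *)

(** Equal power sums give equal sums of every polynomial. A polynomial vanishing at all occurring
    values except [z] then reads off the multiplicity of [z], as natural numbers embed in [R]. *)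
Lemma perm_eq_power_sums (R : numDomainType) (s t : seq R) :
  (forall n, \sum_(x <- s) x ^+ n = \sum_(x <- t) x ^+ n) -> perm_eq s t.
Proof.
move=> pst.
have polyst (p : {poly R}) : \sum_(x <- s) p.[x] = \sum_(x <- t) p.[x].
  under eq_bigr do rewrite horner_coef.
  under [RHS]eq_bigr do rewrite horner_coef.
  rewrite exchange_big [RHS]exchange_big /=.
  by apply: eq_bigr => i _; rewrite -!mulr_sumr pst.
apply/allP => z zst /=.
pose p := \prod_(w <- rem z (undup (s ++ t))) ('X - w%:P).
have pz : p.[z] != 0.
  rewrite -rootE root_prod_XsubC mem_rem_uniq ?undup_uniq//.
  by rewrite inE eqxx.
have count_p u : {subset u <= s ++ t} ->
    \sum_(x <- u) p.[x] = p.[z] *+ count_mem z u.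
  move=> ust; rewrite (bigID (pred1 z))/= [X in _ + X]big1_seq ?addr0.
    rewrite (eq_bigr (fun=> p.[z])) => [|x /eqP ->//].
    by rewrite big_const_seq iter_addr_0.
  move=> x /andP[xz xu]; apply/eqP; rewrite -rootE root_prod_XsubC.
  by rewrite mem_rem_uniq ?undup_uniq// inE xz mem_undup; exact: ust.
have := polyst p.
rewrite !count_p; last 2 first.
- by move=> x xu; rewrite mem_cat xu orbT.
- by move=> x xu; rewrite mem_cat xu.
by rewrite -mulr_natr -[RHS]mulr_natr => /(mulfI pz)/eqP; rewrite eqr_nat.
Qed.

Lemma sum_ord_pairs_sym (V : zmodType) (k : nat) (F : 'I_k -> 'I_k -> V) :
  (forall i j, F i j = F j i) ->
  \sum_i \sum_j F i j =
  \sum_i F i i + (\sum_(ij : 'I_k * 'I_k | (ij.1 < ij.2)%N) F ij.1 ij.2) *+ 2.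
Proof.
move=> Fsym; rewrite pair_bigA /=.
rewrite (bigID (fun ij : 'I_k * 'I_k => ij.1 == ij.2))/=; congr (_ + _).
  rewrite (reindex_onto (fun i => (i, i)) fst)/=; last by case=> i j /= /eqP ->.
  by apply: eq_bigl => i; rewrite !eqxx.
rewrite (bigID (fun ij : 'I_k * 'I_k => (ij.1 < ij.2)%N))/= mulr2n; congr (_ + _).
  apply: eq_bigl => -[i j] /=.
  by rewrite andb_idl// => ij; rewrite -val_eqE/= ltn_eqF.
(* Swapping the two indices carries the part below the diagonal onto the part above it. *)
rewrite (reindex_inj (h := fun ij : 'I_k * 'I_k => (ij.2, ij.1)))/=; last first.
  by case=> i j [i' j'] /= [-> ->].
apply: eq_big => [[i j]|[i j] _] //=.
by rewrite -leqNgt ltn_neqAle -val_eqE/= eq_sym.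
Qed.

(** * Pairwise distances and rigid motions *)

Section PairDistances.
Variables (R : realType) (d k : nat).
Implicit Types p q : 'I_k -> 'rV[R]_d.

Lemma sqnormN (v : 'rV[R]_d) : sqnorm (- v) = sqnorm v.
Proof. by apply: eq_bigr => i _; rewrite mxE sqrrN. Qed.

Lemma sqnorm0 : sqnorm (0 : 'rV[R]_d) = 0.
Proof. by rewrite /sqnorm big1// => i _; rewrite mxE expr0n. Qed.

Lemma perm_eq_pair_dists p q :
  (forall n, \sum_i \sum_j expR (sqnorm (p i - p j)) ^+ n =
             \sum_i \sum_j expR (sqnorm (q i - q j)) ^+ n) ->
  perm_eq (pair_dists p) (pair_dists q).
Proof.
move=> pq.
pose L (r : 'I_k -> 'rV[R]_d) := [seq expR (sqnorm (r ij.1 - r ij.2)) |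
  ij <- enum [pred ij : 'I_k * 'I_k | (ij.1 < ij.2)%N]].
(* Each distance is recovered from [expR] of its square, so it suffices to compare the multisets
   [L p] and [L q]. *)
have pairE r : pair_dists r = [seq Num.sqrt (ln x) | x <- L r].
  by rewrite -map_comp; apply: eq_map => ij /=; rewrite expRK.
rewrite !pairE; apply/perm_map/perm_eq_power_sums => n.
(* The diagonal contributes [k%:R] whatever the configuration, and each unordered pair is counted
   twice. *)
have split r : \sum_i \sum_j expR (sqnorm (r i - r j)) ^+ n =
    k%:R + (\sum_(x <- L r) x ^+ n) *+ 2.
  rewrite sum_ord_pairs_sym => [|i j]; last by rewrite -sqnormN opprB.
  congr (_ + _ *+ 2); last by rewrite big_map big_enum.
  rewrite (eq_bigr (fun=> 1)) ?sumr_const ?card_ord// => i _.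
  by rewrite subrr sqnorm0 expR0 expr1n.
have := pq n; rewrite !split => /addrI/eqP.
by rewrite eqrMn2r => /eqP.
Qed.

Lemma sqnormM_orthogonal (Q : 'M[R]_d) (v : 'rV[R]_d) :
  Q *m Q^T = 1%:M -> sqnorm (v *m Q) = sqnorm v.
Proof.
have sqE (u : 'rV[R]_d) : sqnorm u = (u *m u^T) 0 0.
  by rewrite mxE; apply: eq_bigr => i _; rewrite mxE expr2.
by move=> QQ; rewrite !sqE trmx_mul mulmxA -(mulmxA v) QQ mulmx1.
Qed.

(** Orthogonal maps preserve the exponents, translations cancel in the differences, and equal
    weights make the mixture insensitive to relabelling. *)
Lemma gauss_mixture_rigid (g : 'rV[R]_d -> 'rV[R]_d) (s : 'S_k) p q :
  rigid_motion g -> (forall i, g (p (s i)) = q i) ->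
  forall x, gauss_mixture p x = gauss_mixture q (g x).
Proof.
move=> [Q [b [QQ gE]]] pq x.
rewrite /gauss_mixture (reindex_inj (@perm_inj _ s))/=.
apply: eq_bigr => i _; rewrite -pq !gE opprD addrACA subrr addr0 -mulmxBl.
by rewrite sqnormM_orthogonal.
Qed.

End PairDistances.

(** * The Laplace transform of the distribution of distances *)

Section LaplaceTransform.
Variable R : realType.
Local Notation mtuple n := (n.-tuple (measurableTypeR R)).
Local Notation row_of t := (\row_i tnth t i).

(* Integrating [exp (- (y - b)^2 / 2)] against [exp (- s (x - y)^2)] leaves the
   rate [smoothed s] in [(x - b)^2]. *)
Definition smoothed (s : R) : R := 2^-1 * s / (2^-1 + s).

Lemma measurable_gauss (c b : R) :
  measurable_fun setT (fun x : R => expR (- (c * (x - b) ^+ 2))).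
Proof.
apply: measurableT_comp => //; apply: measurableT_comp => //.
by apply: measurable_funM => //; apply: measurable_funX; exact: measurable_funB.
Qed.

Lemma measurable_gauss_mul (b s x : R) :
  measurable_fun setT (fun y : R =>
    expR (- (2^-1 * (y - b) ^+ 2)) * expR (- (s * (x - y) ^+ 2))).
Proof.
apply: measurable_funM; first exact: measurable_gauss.
by under eq_fun do rewrite -[x - _]opprB sqrrN; exact: measurable_gauss.
Qed.

Lemma integral_gauss_mul (b s x : R) : 0 < 2^-1 + s ->
  (\int[@lebesgue_measure R]_y
     (expR (- (2^-1 * (y - b) ^+ 2)) * expR (- (s * (x - y) ^+ 2)))%:E =
   (Num.sqrt (pi / (2^-1 + s)) * expR (- (smoothed s * (x - b) ^+ 2)))%:E)%E.
Proof.
move=> s0.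
have s1 : 1 + s * 2 != 0 by rewrite gt_eqF//; lra.
under eq_integral => y _.
  (* Completing the square in [y]: the new centre is the mean of [b] and [x] with weights [2^-1] and
     [s]. Only [2^-1 + s] must be positive, so [s] may be negative. *)
  rewrite -expRD (_ : _ + _ = - (smoothed s * (x - b) ^+ 2) +
      - ((2^-1 + s) * (y - (2^-1 * b + s * x) / (2^-1 + s)) ^+ 2)); last first.
    by rewrite /smoothed; field.
  rewrite expRD EFinM; over.
rewrite ge0_integralZl//=.
- by rewrite integral_gauss// -EFinM mulrC.
- by apply/measurable_EFinP; exact: measurable_gauss.
Qed.

Lemma expR_sqnorm (d : nat) (c : R) (v : 'rV[R]_d) :
  expR (- (c * sqnorm v)) = \prod_i expR (- (c * v 0 i ^+ 2)).
Proof. by rewrite -expR_sum /sqnorm mulr_sumr sumrN. Qed.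

(** Everything factors over the coordinates. Integrating out [y] leaves a Gaussian of rate
    [smoothed s] around [b], and integrating out [x] is the same computation with that rate in place
    of [s], hence [smoothed] applied twice. *)
Lemma Rd_int2_gauss (d : nat) (c s : R) (a b : 'rV[R]_d) :
  0 <= c -> 0 < 2^-1 + s -> 0 < 2^-1 + smoothed s ->
  Rd_int (fun x => Rd_int (fun y =>
    (c * expR (- (2^-1 * sqnorm (x - a))) * expR (- (2^-1 * sqnorm (y - b))) *
     expR (- (s * sqnorm (x - y))))%:E)) =
  (c * (Num.sqrt (pi / (2^-1 + s)) * Num.sqrt (pi / (2^-1 + smoothed s))) ^+ d *
   expR (- (smoothed (smoothed s) * sqnorm (a - b))))%:E.
Proof.
move=> c0 s0 s1.
set K1 := Num.sqrt (pi / (2^-1 + s)); set K2 := Num.sqrt (pi / _).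
pose g x i y := expR (- (2^-1 * (y - b 0 i) ^+ 2)) * expR (- (s * (x - y) ^+ 2)).
pose h i x := expR (- (2^-1 * (x - a 0 i) ^+ 2)) *
  (K1 * expR (- (smoothed s * (x - b 0 i) ^+ 2))).
have inner (x : 'rV[R]_d) : Rd_int (fun y =>
    (c * expR (- (2^-1 * sqnorm (x - a))) * expR (- (2^-1 * sqnorm (y - b))) *
     expR (- (s * sqnorm (x - y))))%:E) = (c * \prod_i h i (x 0 i))%:E.
  transitivity (Rd_int (fun y : 'rV[R]_d =>
      (c * expR (- (2^-1 * sqnorm (x - a))) * \prod_i g (x 0 i) i (y 0 i))%:E)).
    congr Rd_int; apply/funext => y.
    rewrite -mulrA; congr (_ * _)%:E; rewrite !expR_sqnorm -big_split/=.
    by apply: eq_bigr => i _; rewrite !mxE.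
  rewrite (@Rd_int_prod _ _ (fun i => g (x 0 i) i)
    (fun i => K1 * expR (- (smoothed s * (x 0 i - b 0 i) ^+ 2)))).
  - rewrite -mulrA expR_sqnorm -big_split/=; congr (_ * _)%:E.
    by apply: eq_bigr => i _; rewrite !mxE.
  - by rewrite mulr_ge0 ?expR_ge0.
  - by move=> i y; rewrite mulr_ge0 ?expR_ge0.
  - by move=> i; exact: measurable_gauss_mul.
  - by move=> i; exact: integral_gauss_mul.
under eq_fun do rewrite inner.
(* Here [a 0 i] is the centre and [b 0 i] the fixed point, whence the difference in this order;
   squaring removes the sign. *)
rewrite (@Rd_int_prod _ _ h (fun i =>
  K1 * (K2 * expR (- (smoothed (smoothed s) * (b 0 i - a 0 i) ^+ 2)))))//.
- under eq_bigr do rewrite mulrA.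
  rewrite big_split/= prodr_const card_ord mulrA expR_sqnorm.
  congr (_ * _)%:E; apply: eq_bigr => i _.
  by rewrite !mxE -opprB sqrrN.
- by move=> i x; rewrite !mulr_ge0 ?expR_ge0 ?sqrtr_ge0.
- move=> i; apply: measurable_funM; first exact: measurable_gauss.
  by apply: measurable_funM => //; exact: measurable_gauss.
- move=> i; rewrite [RHS]EFinM -(integral_gauss_mul (a 0 i) (b 0 i) s1).
  rewrite -[RHS]ge0_integralZl; last 4 first.
  + exact: measurableT.
  + by apply/measurable_EFinP; exact: measurable_gauss_mul.
  + by move=> x _; rewrite lee_fin mulr_ge0 ?expR_ge0.
  + by rewrite lee_fin sqrtr_ge0.
  by apply: eq_integral => x _; rewrite -EFinM /h mulrCA -[x - b 0 i]opprB sqrrN.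
Qed.

Lemma measurable_sqnorm_row (d : nat) d' (T : measurableType d')
    (f : T -> 'rV[R]_d) :
  (forall i, measurable_fun setT (fun z => f z 0 i)) ->
  measurable_fun setT (fun z => sqnorm (f z)).
Proof.
by move=> mf; apply: measurable_sum => i; exact: measurable_funX.
Qed.

Lemma measurable_sqnorm_dist (d : nat) :
  measurable_fun [set: mtuple d * mtuple d]
    (fun z => sqnorm (row_of z.1 - row_of z.2)).
Proof.
apply: measurable_sqnorm_row => i; under eq_fun do rewrite !mxE.
by apply: measurable_funB; apply: (measurableT_comp (measurable_tnth i)).
Qed.

Lemma measurable_gauss_mixture (d k : nat) (mu : 'I_k -> 'rV[R]_d) d'
    (T : measurableType d') (f : T -> mtuple d) : measurable_fun setT f ->
  measurable_fun setT (fun z => gauss_mixture mu (row_of (f z))).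
Proof.
move=> mf; apply: measurable_sum => i; apply: measurable_funM => //.
apply: measurableT_comp => //; apply: measurableT_comp => //.
apply: measurable_funM => //; apply: measurable_sqnorm_row => j.
under eq_fun do rewrite !mxE.
by apply: measurable_funB => //; apply: (measurableT_comp (measurable_tnth j)).
Qed.

Lemma gauss_mixture_ge0 (d k : nat) (mu : 'I_k -> 'rV[R]_d) x :
  0 <= gauss_mixture mu x.
Proof.
by apply: sumr_ge0 => i _; rewrite mulr_ge0 ?expR_ge0 ?invr_ge0 ?mulr_ge0 ?sqrtr_ge0.
Qed.

(** The expectation of [h] at the squared distance of two independent points of density [rho]; an
    exponential [h] gives the Laplace transform. *)
Definition expected_dist (d : nat) (rho : 'rV[R]_d -> R) (h : R -> R) :=
  Rd_int (fun x => Rd_int (fun y => (rho x * rho y * h (sqnorm (x - y)))%:E)).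

Lemma same_dist_expected (d k : nat) (mu nu : 'I_k -> 'rV[R]_d) (h : R -> R) :
  same_dist_of_dists (gauss_mixture mu) (gauss_mixture nu) ->
  measurable_fun setT h -> (forall r, 0 <= h r) ->
  expected_dist (gauss_mixture mu) h = expected_dist (gauss_mixture nu) h.
Proof.
move=> same mh h0.
have [P PE] := Rd_int2_measure R d.
pose W (p : 'I_k -> 'rV[R]_d) (z : mtuple d * mtuple d) :=
  gauss_mixture p (row_of z.1) * gauss_mixture p (row_of z.2).
have W0 p z : 0 <= W p z by rewrite mulr_ge0 ?gauss_mixture_ge0.
have mW p : measurable_fun setT (W p).
  by apply: measurable_funM; exact: measurable_gauss_mixture.
have mS := @measurable_sqnorm_dist d.
(* Stated for general [f] so as to apply both to [h] and to the indicators occurring in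
   [dist_of_dists]. *)
have WE p (f : R -> R) : measurable_fun setT f -> (forall r, 0 <= f r) ->
    Rd_int (fun x => Rd_int (fun y =>
      ((gauss_mixture p x * gauss_mixture p y)%:E * (f (sqnorm (x - y)))%:E)%E)) =
    (\int[P]_z ((W p z)%:E * (f (sqnorm (row_of z.1 - row_of z.2)))%:E))%E.
  move=> mf f0; rewrite PE// => [x y|].
    by rewrite mule_ge0// lee_fin// mulr_ge0 ?gauss_mixture_ge0.
  apply: emeasurable_funM; apply/measurable_EFinP; first exact: mW.
  exact: (measurableT_comp mf mS).
have expE p : expected_dist (gauss_mixture p) h =
    (\int[P]_z ((W p z)%:E * (h (sqnorm (row_of z.1 - row_of z.2)))%:E))%E.
  by rewrite -WE.
rewrite !expE.
have mhE : measurable_fun setT (fun r => (h r)%:E) by exact/measurable_EFinP.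
have h0E r : (0 <= (h r)%:E)%E by rewrite lee_fin.
apply: (eq_ge0_integral_comp (W0 mu) (mW mu) (W0 nu) (mW nu) mS _ mhE h0E).
move=> B mB; have mB1 : measurable_fun setT (\1_B : R -> R).
  exact: measurable_indic.
have B0 r : 0 <= (\1_B r : R) by [].
exact: etrans (esym (WE mu _ mB1 B0)) (etrans (same B mB) (WE nu _ mB1 B0)).
Qed.

(** The product of the two mixtures expands into one Gaussian pair per [(i, j)], each evaluated by
    [Rd_int2_gauss]. The factor in front of the double sum does not involve [mu]. *)
Lemma expected_dist_gauss_mixture (d k : nat) (mu : 'I_k -> 'rV[R]_d) (s : R) :
  0 < 2^-1 + s -> 0 < 2^-1 + smoothed s ->
  expected_dist (gauss_mixture mu) (fun r => expR (- (s * r))) =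
  ((k%:R * Num.sqrt ((2 * pi) ^+ d))^-1 ^+ 2 *
   (Num.sqrt (pi / (2^-1 + s)) * Num.sqrt (pi / (2^-1 + smoothed s))) ^+ d *
   \sum_i \sum_j expR (- (smoothed (smoothed s) * sqnorm (mu i - mu j))))%:E.
Proof.
move=> s0 s1; set w := (k%:R * _)^-1.
have w0 : 0 <= w by rewrite invr_ge0 mulr_ge0 ?sqrtr_ge0.
have [P PE] := Rd_int2_measure R d.
pose F i j (x y : 'rV[R]_d) :=
  w ^+ 2 * expR (- (2^-1 * sqnorm (x - mu i))) *
  expR (- (2^-1 * sqnorm (y - mu j))) * expR (- (s * sqnorm (x - y))).
have F0 i j x y : 0 <= F i j x y by rewrite !mulr_ge0 ?expR_ge0.
have mF i j : measurable_fun [set: mtuple d * mtuple d]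
    (fun z => F i j (row_of z.1) (row_of z.2)).
  have mE c (f : mtuple d * mtuple d -> 'rV[R]_d) :
      (forall l, measurable_fun setT (fun z => f z 0 l)) ->
      measurable_fun setT (fun z => expR (- (c * sqnorm (f z)))).
    move=> mf; apply: measurableT_comp => //; apply: measurableT_comp => //.
    by apply: measurable_funM => //; exact: measurable_sqnorm_row.
  have mcoord (f : mtuple d * mtuple d -> mtuple d) l :
      measurable_fun setT f -> measurable_fun setT (fun z => tnth (f z) l : R).
    exact: (measurableT_comp (measurable_tnth l)).
  apply: measurable_funM; [apply: measurable_funM;
      [apply: measurable_funM; first exact: measurable_cst|]|];
    by apply: mE => l; under eq_fun do rewrite !mxE;
      apply: measurable_funB => //; exact: mcoord.
have sumE x y : gauss_mixture mu x * gauss_mixture mu y *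
    expR (- (s * sqnorm (x - y))) = \sum_(ij : 'I_k * 'I_k) F ij.1 ij.2 x y.
  rewrite /gauss_mixture !mulr_suml -(pair_bigA _ (fun i j => F i j x y))/=.
  apply: eq_bigr => i _; rewrite mulr_sumr mulr_suml; apply: eq_bigr => j _.
  by rewrite /F expr2 -/w; ring.
(* The sum is exchanged with the integral under the single measure [P], and each term is then turned
   back into an iterated integral. *)
rewrite /expected_dist PE; last 2 first.
- by move=> x y; rewrite lee_fin sumE sumr_ge0.
- apply/measurable_EFinP; under eq_fun do rewrite sumE.
  by apply: measurable_sum => ij; exact: mF.
under eq_integral do rewrite sumE -sumEFin.
rewrite ge0_integral_sum//; last 2 first.
- by move=> ij; apply/measurable_EFinP; exact: mF.
- by move=> ij z _; rewrite lee_fin.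
rewrite pair_bigA mulr_sumr -sumEFin; apply: eq_bigr => -[i j] _ /=.
rewrite -Rd_int2_gauss ?exprn_ge0// -(PE (fun x y => (F i j x y)%:E)) => [//|x y|].
  by rewrite lee_fin.
by apply/measurable_EFinP; exact: mF.
Qed.

Lemma same_dist_power_sums (d k : nat) (mu nu : 'I_k -> 'rV[R]_d) (n : nat) :
  (0 < k)%N ->
  same_dist_of_dists (gauss_mixture mu) (gauss_mixture nu) ->
  \sum_i \sum_j expR (sqnorm (mu i - mu j)) ^+ n =
  \sum_i \sum_j expR (sqnorm (nu i - nu j)) ^+ n.
Proof.
move=> k0 same.
(* chosen so that [smoothed (smoothed s) = - n] *)
pose s : R := - n%:R / (1 + 4 * n%:R).
have n0 : 0 <= n%:R :> R by [].
have n4 : 0 < 1 + 4 * n%:R :> R by lra.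
have n2 : 0 < 1 + 2 * n%:R :> R by lra.
(* Both rates, [2^-1 + s] and [2^-1 + smoothed s], come out positive, so both Gaussian integrals
   converge although [s] is at most 0. *)
have sE : 2^-1 + s = (1 + 2 * n%:R) / (2 * (1 + 4 * n%:R)).
  by rewrite /s; field; rewrite gt_eqF.
have s0 : 0 < 2^-1 + s by rewrite sE divr_gt0// mulr_gt0.
have sm : smoothed s = - n%:R / (1 + 2 * n%:R).
  by rewrite /smoothed sE /s; field; rewrite !gt_eqF.
have smE : 2^-1 + smoothed s = (2 * (1 + 2 * n%:R))^-1.
  by rewrite sm; field; rewrite gt_eqF.
have s1 : 0 < 2^-1 + smoothed s by rewrite smE invr_gt0 mulr_gt0.
have smm : smoothed (smoothed s) = - n%:R.
  by rewrite {1}/smoothed smE sm; field; rewrite gt_eqF.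
have := @same_dist_expected _ _ _ _ (fun r => expR (- (s * r))) same.
rewrite !expected_dist_gauss_mixture// smm => sameE.
have /sameE{sameE} sameE : measurable_fun setT (fun r : R => expR (- (s * r))).
  by apply: measurableT_comp => //; exact: measurableT_comp.
(* Both sides are finite, so this is an equality of reals, and the common prefactor cancels once it
   is shown to be nonzero. *)
have [/mulfI powI] := sameE (fun r => expR_ge0 _).
have powE (p : 'I_k -> 'rV[R]_d) :
    \sum_i \sum_j expR (sqnorm (p i - p j)) ^+ n =
    \sum_i \sum_j expR (- (- n%:R * sqnorm (p i - p j))).
  apply: eq_bigr => i _; apply: eq_bigr => j _.
  by rewrite mulNr opprK expRM_natl.
rewrite !powE; apply: powI.
rewrite mulf_neq0// expf_neq0// ?mulf_neq0 ?invr_neq0 ?mulf_neq0//.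
- by rewrite pnatr_eq0 -lt0n.
- by rewrite gt_eqF// sqrtr_gt0 exprn_gt0// mulr_gt0 ?pi_gt0.
- by rewrite gt_eqF// sqrtr_gt0 divr_gt0 ?pi_gt0.
- by rewrite gt_eqF// sqrtr_gt0 divr_gt0 ?pi_gt0.
Qed.

End LaplaceTransform.

(** * Reconstruction of the mixture *)

Theorem theorem3p1 (R : realType) (d k : nat) (hd : (1 <= d)%N) (hk : (d + 2 <= k)%N)
    (mu : 'I_k -> 'rV[R]_d) (hrec : reconstructible mu)
    (nu : 'I_k -> 'rV[R]_d)
    (hsame : same_dist_of_dists (gauss_mixture mu) (gauss_mixture nu)) :
  exists g : 'rV[R]_d -> 'rV[R]_d, rigid_motion g /\
    forall x : 'rV[R]_d, gauss_mixture mu x = gauss_mixture nu (g x).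
Proof.
have k0 : (0 < k)%N by apply: leq_trans hk; rewrite addn2.
(* The means of the second mixture have the same pairwise distances, so they serve as the competing
   configuration in the reconstructibility of [mu]. *)
have [g [rg [s gs]]] := hrec nu (perm_eq_pair_dists (fun n =>
  same_dist_power_sums n k0 hsame)).
by exists g; split => // x; exact: gauss_mixture_rigid rg gs x.
Qed.
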